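(* Let $n\ge 2$ be an integer with prime decomposition $n=p_1^{y_1}\cdots p_r^{y_r}$ (the $p_i$ pairwise distinct primes, $y_i\ge 1$). Let $H$ be a finite index subgroup of $\Gamma_n$ of the form $$H=\langle t_1^{k_{11}}t_2^{k_{12}}\cdots t_r^{k_{1r}},\ t_2^{k_{22}}\cdots t_r^{k_{2r}},\ \dots,\ t_r^{k_{rr}},\ a^m\rangle$$ with integers $k_{11}>0$, $0\le k_{ij}<k_{jj}$ for all $1\le i<j\le r$, and $m>0$ such that $\gcd(m,n)=1$. Then $H\simeq\Gamma_k$ for some integer $k\ge 2$ if and only if $k_{ij}=0$ for all $1\le i<j\le r$.
   Context: For an integer $n\ge 2$ with prime decomposition $n=p_1^{y_1}\cdots p_r^{y_r}$ (the $p_i$ pairwise distinct primes, $y_i\ge 1$), $$\Gamma_n=\langle a,t_1,\dots,t_r\mid t_it_j=t_jt_i\ (i\ne j),\ t_iat_i^{-1}=a^{p_i^{y_i}}\ (i=1,\dots,r)\rangle.$$ *)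

(* Defs.v *)
From HB Require Import structures.
From mathcomp Require Import all_boot.
From mathcomp Require Import boolp classical_sets.

Set Implicit Arguments.
Unset Strict Implicit.
Unset Printing Implicit Defensive.

Local Open Scope quotient_scope.
Local Open Scope group_scope.

(* The letter (x, false) stands for the generator x, (x, true) for x^-1. *)
Definition word (X : Type) := seq (X * bool).

Definition inv_word (X : Type) (w : word X) : word X :=
  rev [seq (l.1, ~~ l.2) | l <- w].

Section Presentation.
Variables (X : choiceType) (R : word X -> word X -> Prop).

(* Equality in < X | u = v for R u v >: the congruence on words generated by R
   and by the free cancellations. *)
Inductive pres_eq : word X -> word X -> Prop :=
| PresRel u v : R u v -> pres_eq u v
| PresCancel x b : pres_eq [:: (x, b); (x, ~~ b)] [::]
| PresRefl u : pres_eq u u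
| PresSym u v : pres_eq u v -> pres_eq v u
| PresTrans u v w : pres_eq u v -> pres_eq v w -> pres_eq u w
| PresCat u u' v v' :
    pres_eq u u' -> pres_eq v v' -> pres_eq (u ++ v) (u' ++ v').

Definition pres_eqb : rel (word X) := fun u v => `[< pres_eq u v >].

Lemma pres_eqb_equiv : equiv_class_of pres_eqb.
Proof.
split=> [u|u v|v u w].
- exact/asboolP/PresRefl.
- by apply/asboolP/asboolP; apply: PresSym.
- by move=> /asboolP uv /asboolP vw; apply/asboolP/(PresTrans uv vw).
Qed.

Canonical pres_eqb_equiv_rel := EquivRelPack pres_eqb_equiv.

Definition presented := {eq_quot pres_eqb}.
HB.instance Definition _ := Choice.on presented.
HB.instance Definition _ := EqQuotient.on presented.

Definition pres_class (w : word X) : presented := \pi_presented w.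

Lemma pres_eqP u v : pres_eq u v <-> pres_class u = pres_class v.
Proof.
split=> [uv|/eqmodP/asboolP//].
by apply/eqmodP/asboolP.
Qed.

Lemma pres_classP (x : presented) : exists w, x = pres_class w.
Proof. by exists (repr x); rewrite /pres_class reprK. Qed.

Lemma pres_eq_repr w : pres_eq (repr (pres_class w)) w.
Proof. by apply/pres_eqP; rewrite /pres_class reprK. Qed.

Lemma pres_eq_mulVw w : pres_eq (inv_word w ++ w) [::].
Proof.
elim: w => [|[x b] w IHw]; first exact: PresRefl.
rewrite /inv_word /= rev_cons -/(inv_word w) cat_rcons /=.
apply: PresTrans IHw; apply: PresCat; first exact: PresRefl.
rewrite -[X in pres_eq _ X]cat0s -[_ :: _ :: w]/([:: (x, ~~ b); (x, b)] ++ w).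
by apply: PresCat (PresRefl _); rewrite -[in (x, b)](negbK b); apply: PresCancel.
Qed.

Lemma inv_wordK : involutive (@inv_word X).
Proof.
move=> w; rewrite /inv_word map_rev revK -map_comp -[RHS]map_id.
by apply: eq_map => -[x b] /=; rewrite negbK.
Qed.

Lemma pres_eq_inv u v : pres_eq u v -> pres_eq (inv_word u) (inv_word v).
Proof.
move=> uv; apply: (@PresTrans _ (inv_word u ++ v ++ inv_word v)).
  rewrite -[X in pres_eq X _]cats0; apply: PresCat (PresRefl _) _.
  by apply: PresSym; have := pres_eq_mulVw (inv_word v); rewrite inv_wordK.
rewrite catA -[X in pres_eq _ X]cat0s; apply: PresCat (PresRefl _).
by apply: PresTrans (pres_eq_mulVw u); apply: PresCat (PresRefl _) (PresSym uv).
Qed.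

Definition pres_mul (x y : presented) : presented :=
  pres_class (repr x ++ repr y).
Definition pres_one : presented := pres_class [::].
Definition pres_inv (x : presented) : presented :=
  pres_class (inv_word (repr x)).

Lemma pres_mulE u v :
  pres_mul (pres_class u) (pres_class v) = pres_class (u ++ v).
Proof. by apply/pres_eqP/PresCat; apply: pres_eq_repr. Qed.

Lemma pres_invE u : pres_inv (pres_class u) = pres_class (inv_word u).
Proof. by apply/pres_eqP/pres_eq_inv/pres_eq_repr. Qed.

Lemma pres_mulA : associative pres_mul.
Proof.
move=> x y z; have [u ->] := pres_classP x; have [v ->] := pres_classP y.
by have [w ->] := pres_classP z; rewrite !pres_mulE catA.
Qed.

Lemma pres_mul1 : left_id pres_one pres_mul.
Proof. by move=> x; have [u ->] := pres_classP x; rewrite pres_mulE. Qed.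

Lemma pres_mulr1 : right_id pres_one pres_mul.
Proof. by move=> x; have [u ->] := pres_classP x; rewrite pres_mulE cats0. Qed.

Lemma pres_mulV : left_inverse pres_one pres_inv pres_mul.
Proof.
move=> x; have [u ->] := pres_classP x; rewrite pres_invE pres_mulE.
exact/pres_eqP/pres_eq_mulVw.
Qed.

Lemma pres_mulrV : right_inverse pres_one pres_inv pres_mul.
Proof.
move=> x; have [u ->] := pres_classP x; rewrite pres_invE pres_mulE.
by apply/pres_eqP; have := pres_eq_mulVw (inv_word u); rewrite inv_wordK.
Qed.

HB.instance Definition _ := isGroup.Build presented
  pres_mulA pres_mul1 pres_mulr1 pres_mulV pres_mulrV.

Definition pres_gen (x : X) : presented := pres_class [:: (x, false)].

End Presentation.

Section GeneratedSubgroup.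
Variables (G : groupType) (S : set G).

Definition is_subgroup (A : set G) : Prop :=
  A 1 /\ forall x y, A x -> A y -> A (x / y).

Definition subgroup_gen : set G := smallest is_subgroup S.

Lemma subgroup_gen_closed : group_closed [in subgroup_gen].
Proof.
split=> [|x y /set_mem Gx /set_mem Gy]; apply/mem_set.
  by move=> A [[]].
by move=> A AP; have [[_ AF] _] := AP; apply: AF; [apply: Gx|apply: Gy].
Qed.

Definition subgroup_type := {x : G | x \in subgroup_gen}.
HB.instance Definition _ := SubChoice.on subgroup_type.
HB.instance Definition _ :=
  SubChoice_isSubGroup.Build G [in subgroup_gen] subgroup_type
    subgroup_gen_closed.

End GeneratedSubgroup.

Definition finite_index (G : groupType) (H : set G) : Prop :=
  exists s : seq G, forall x, exists2 g, g \in s & H (g^-1 * x).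

Definition isomorphic (G H : groupType) : Prop :=
  exists f : {multiplicative G -> H}, bijective f.

Definition prime_decomposition (n r : nat) (p y : 'I_r -> nat) : Prop :=
  [/\ forall i, prime (p i), injective p, forall i, (0 < y i)%N
    & n = (\prod_(i < r) p i ^ y i)%N].

(* Generators of Gamma: None is a, and Some i is t_i. *)
Inductive Gamma_rel (r : nat) (p y : 'I_r -> nat) :
    word (option 'I_r) -> word (option 'I_r) -> Prop :=
| GammaComm i j : i != j ->
    Gamma_rel p y [:: (Some i, false); (Some j, false)]
                  [:: (Some j, false); (Some i, false)]
| GammaConj i :
    Gamma_rel p y [:: (Some i, false); (None, false); (Some i, true)]
                  (nseq (p i ^ y i) (None, false)).

Definition Gamma (r : nat) (p y : 'I_r -> nat) : groupType :=
  presented (Gamma_rel p y).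

Definition Gamma_a (r : nat) (p y : 'I_r -> nat) : Gamma p y :=
  pres_gen (Gamma_rel p y) None.

Definition Gamma_t (r : nat) (p y : 'I_r -> nat) (i : 'I_r) : Gamma p y :=
  pres_gen (Gamma_rel p y) (Some i).

(* Gamma is indexed by a prime decomposition rather than by n, because the shape
   of the generators of H depends on the order of the primes; reordering the
   primes of k gives isomorphic groups, so any decomposition of k may be used. *)
Definition isomorphic_to_Gamma (G : groupType) (k : nat) : Prop :=
  exists (s : nat) (p y : 'I_s -> nat),
    prime_decomposition k p y /\ isomorphic G (Gamma p y).

Definition H_gens (r : nat) (p y : 'I_r -> nat) (K : 'I_r -> 'I_r -> nat)
    (m : nat) : set (Gamma p y) :=
  [set x | (exists i : 'I_r,
              x = \prod_(j < r | (i <= j)%N) Gamma_t p y j ^+ K i j)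
           \/ x = Gamma_a p y ^+ m].
Arguments H_gens {r} p y K m.

(* Main.v *)
Require Import Defs.
From HB Require Import structures.
From mathcomp Require Import all_boot all_order all_algebra.
From mathcomp Require Import zify.
From mathcomp Require Import boolp classical_sets.

(** Gamma_n acts on the rational line by affine maps: [a] is the translation by
    1 and [t_i] is the dilation of ratio [q_i = p_i ^ y_i].  Two facts make this
    action the only tool that is needed.  It is faithful
    ([Gamma_to_affine_inj]): every x is a left fraction with
    [a^m T(u) x = a^n T(v)] for products T(u), T(v) of the t's
    ([Gamma_fraction]), and when x acts trivially, unique factorization gives
    T(u) = T(v) and evaluation at 0 gives m = n.  And the slope of an element,
    the ratio of its affine map, is preserved by every injective morphism from
    one such group to another ([slope_embedding]), although the definition of
    the slope refers to a particular presentation.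

    Suppose that H is isomorphic to Gamma_k. By the second fact, the slopes of
    the elements of H are exactly the slopes of Gamma_k, the multiplicative
    group generated by powers of distinct primes. This set has a splitting
    property: with every slope it contains its P-part, for each prime P
    ([slope_split]). On the other hand the vectors of p_j-adic valuations of
    slopes of H form the lattice spanned by the rows [(y_j K_ij)_j] of an
    upper triangular matrix ([H_slope_lattice]). Splitting off the p_j-part of
    row i produces a lattice vector whose only nonzero coordinate is [y_j
    K_ij], in position j; by triangularity this coordinate is a multiple of
    the diagonal entry [y_j K_jj] ([H_slope_dvd]), so that 0 <= K_ij < K_jj
    forces K_ij = 0 ([H_gens_rigid]).

    Conversely, if K is diagonal, then [t_i |-> t_i ^ K_ii, a |-> a ^ m] maps
    Gamma_k, for [k = prod_i p_i ^ (y_i K_ii)], onto H.  On affine maps it is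
    conjugation by the dilation of ratio m, hence it is injective
    ([H_gens_diagonal]). *)

Set Implicit Arguments.
Unset Strict Implicit.
Unset Printing Implicit Defensive.

Import Order.TTheory GRing.Theory Num.Theory.
Local Open Scope group_scope.

(** * Morphisms and isomorphisms of groups *)

Lemma morph_1 (G H : groupType) (f : G -> H) :
  {morph f : x y / x * y} -> f 1 = 1.
Proof. by move=> fM; apply: (mulgI (f 1)); rewrite -fM !mulg1. Qed.

Lemma morph_V (G H : groupType) (f : G -> H) :
  {morph f : x y / x * y} -> {morph f : x / x^-1}.
Proof.
by move=> fM x; apply/esym/mulg1_eq; rewrite -fM mulgV morph_1.
Qed.

Lemma morph_X (G H : groupType) (f : G -> H) n :
  {morph f : x y / x * y} -> {morph f : x / x ^+ n}.
Proof.
move=> fM x; elim: n => [|n IHn]; first by rewrite !expg0 morph_1.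
by rewrite !expgS fM IHn.
Qed.

Lemma isomorphic_sym (G H : groupType) : isomorphic G H -> isomorphic H G.
Proof.
move=> [f [g fK gK]].
have gM : {morph g : x y / x * y}.
  by move=> x y; apply: (can_inj fK); rewrite gmulfM !gK.
pose gA := isMultiplicative.Build _ _ g gM.
pose gS : {multiplicative H -> G} := HB.pack g gA.
by exists gS; exists f.
Qed.

Lemma morph_isomorphic (G H : groupType) (f : G -> H) :
  {morph f : x y / x * y} -> injective f -> (forall y, exists x, f x = y) ->
  isomorphic G H.
Proof.
move=> fM finj fsurj; have [g gK] := choice fsurj.
pose fA := isMultiplicative.Build _ _ f fM.
pose fS : {multiplicative G -> H} := HB.pack f fA.
by exists fS; exists g => // x; apply: finj; rewrite gK.
Qed.

(** * The universal property of a presented group *)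

Section PresentedLift.
Variables (X : choiceType) (R : word X -> word X -> Prop).
Local Notation G := (presented R).

Lemma pres_class_cat u v :
  pres_class R (u ++ v) = pres_class R u * pres_class R v :> G.
Proof. exact/esym/pres_mulE. Qed.

Lemma presented_ind (P : G -> Prop) :
  P 1 -> (forall c x, P x -> P (pres_gen R c * x)) ->
  (forall c x, P x -> P ((pres_gen R c)^-1 * x)) -> forall x, P x.
Proof.
move=> P1 Pgen PgenV x; have [w ->] := pres_classP x.
elim: w => [|[c b] w IHw]; first exact: P1.
have -> : pres_class R ((c, b) :: w) =
          (if b then (pres_gen R c)^-1 else pres_gen R c) * pres_class R w.
  rewrite -cat1s pres_class_cat; congr (_ * _).
  by case: b => //; apply/esym; apply: pres_invE.
by case: b; [apply: PgenV|apply: Pgen].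
Qed.

Variables (H : groupType) (f : X -> H).

Definition word_eval (w : word X) : H :=
  \prod_(l <- w) (if l.2 then (f l.1)^-1 else f l.1).

Definition presented_lift (x : G) : H := word_eval (repr x).

Hypothesis fR : forall u v, R u v -> word_eval u = word_eval v.

Lemma word_eval_pres_eq u v : pres_eq R u v -> word_eval u = word_eval v.
Proof.
elim=> {u v} [u v|c b|//|u v _ -> //|u v w _ -> _ //|u u' v v' _ Eu _ Ev].
- exact: fR.
- rewrite /word_eval big_cons big_seq1 big_nil /=.
  by case: b; rewrite /= ?mulgV ?mulVg.
- by rewrite /word_eval !big_cat /= -!/(word_eval _) Eu Ev.
Qed.

Lemma presented_liftE w : presented_lift (pres_class R w) = word_eval w.
Proof. exact/word_eval_pres_eq/pres_eq_repr. Qed.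

Lemma presented_liftM : {morph presented_lift : x y / x * y}.
Proof.
move=> x y; have [u ->] := pres_classP x; have [v ->] := pres_classP y.
rewrite -pres_class_cat !presented_liftE.
by rewrite /word_eval big_cat.
Qed.

Lemma presented_lift_gen c : presented_lift (pres_gen R c) = f c.
Proof. by rewrite presented_liftE /word_eval big_seq1. Qed.

End PresentedLift.

(** * Orientation-preserving affine maps of the rational line *)

(** The pair (s, b) stands for the map z |-> s z + b. *)
Definition affine := {u : rat * rat | (0 < u.1)%R}.
HB.instance Definition _ := SubChoice.on affine.

Section Affine.
Local Open Scope ring_scope.

Fact affine_one_subproof : 0 < ((1, 0) : rat * rat).1. Proof. by []. Qed.
Definition affine_one : affine := exist _ (1, 0) affine_one_subproof.

Fact affine_mul_subproof (u v : affine) :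
  0 < ((val u).1 * (val v).1, (val u).2 + (val u).1 * (val v).2).1.
Proof. exact: mulr_gt0 (valP u) (valP v). Qed.
Definition affine_mul (u v : affine) : affine :=
  exist (fun w => 0 < w.1) _ (affine_mul_subproof u v).

Fact affine_inv_subproof (u : affine) :
  0 < ((val u).1^-1, - ((val u).1^-1 * (val u).2)).1.
Proof. by rewrite /= invr_gt0; exact: (valP u). Qed.
Definition affine_inv (u : affine) : affine :=
  exist (fun w => 0 < w.1) _ (affine_inv_subproof u).

Lemma affine_mulA : associative affine_mul.
Proof.
move=> u v w; apply/val_inj; rewrite /= mulrA; congr pair.
by rewrite mulrDr addrA mulrA.
Qed.

Lemma affine_mul1 : left_id affine_one affine_mul.
Proof.
by move=> u; apply/val_inj; rewrite /= !mul1r add0r -surjective_pairing.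
Qed.

Lemma affine_mulr1 : right_id affine_one affine_mul.
Proof.
move=> u; apply/val_inj; rewrite /= !mulr1 mulr0 addr0.
by rewrite -surjective_pairing.
Qed.

Lemma affine_mulV : left_inverse affine_one affine_inv affine_mul.
Proof.
move=> u; apply/val_inj; rewrite /= addNr mulVf //.
by rewrite gt_eqF //; apply: (valP u).
Qed.

Lemma affine_mulrV : right_inverse affine_one affine_inv affine_mul.
Proof.
move=> u; have u0 : (val u).1 != 0 by rewrite gt_eqF //; apply: (valP u).
by apply/val_inj; rewrite /= mulrN mulrA divff // mul1r subrr.
Qed.

HB.instance Definition _ := isGroup.Build affine
  affine_mulA affine_mul1 affine_mulr1 affine_mulV affine_mulrV.

Lemma affine_mulE (u v : affine) :
  val (u * v)%g = ((val u).1 * (val v).1, (val u).2 + (val u).1 * (val v).2).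
Proof. by []. Qed.

Fact dilation_subproof n : (0 < n)%N -> 0 < ((n%:R, 0) : rat * rat).1.
Proof. by rewrite /= ltr0n. Qed.
Definition dilation n (n_gt0 : (0 < n)%N) : affine :=
  exist (fun w => 0 < w.1) _ (dilation_subproof n_gt0).

Fact translation_subproof : 0 < ((1, 1) : rat * rat).1. Proof. by []. Qed.
Definition translation : affine :=
  exist (fun w => 0 < w.1) _ translation_subproof.

Lemma dilation_commute m n (m_gt0 : (0 < m)%N) (n_gt0 : (0 < n)%N) :
  commute (dilation m_gt0) (dilation n_gt0).
Proof.
apply: val_inj; rewrite !affine_mulE; congr pair; first by rewrite mulrC.
by rewrite /= !mulr0.
Qed.

Lemma dilationX m n k (m_gt0 : (0 < m)%N) (n_gt0 : (0 < n)%N) :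
  n = (m ^ k)%N -> (dilation m_gt0 ^+ k)%g = dilation n_gt0.
Proof.
move=> nE; apply: val_inj.
have -> : val (dilation n_gt0) = (n%:R, 0) by [].
rewrite {n_gt0}nE.
elim: k => [|k IHk]; first by rewrite expg0 expn0.
by rewrite expgS affine_mulE IHk /= mulr0 addr0 -natrM expnS.
Qed.

Lemma affine_translationX (u : affine) n :
  (val u).1 = 1 -> val (u ^+ n)%g = (1, (val u).2 *+ n).
Proof.
move=> u1; elim: n => [|n IHn]; first by rewrite mulr0n.
by rewrite expgS affine_mulE IHn u1 !mul1r mulrS.
Qed.

Lemma dilation_translation n (n_gt0 : (0 < n)%N) :
  (dilation n_gt0 * translation = translation ^+ n * dilation n_gt0)%g.
Proof.
apply: val_inj; rewrite !affine_mulE affine_translationX //; congr pair => /=.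
  by rewrite mulrC.
by rewrite mulr0 mulr1 addr0 add0r.
Qed.

End Affine.

(** * Valuations of rational numbers *)

Section Valuation.
Local Open Scope ring_scope.

Definition ratval (P : nat) (x : rat) : int :=
  (logn P `|numq x|)%:Z - (logn P `|denq x|)%:Z.

(** The defining fraction of [ratval] is reduced; multiplicativity needs the
    same formula for an arbitrary one. *)
Lemma ratval_frac P (a b : int) : a != 0 -> b != 0 ->
  ratval P (a%:~R / b%:~R) = (logn P `|a|)%:Z - (logn P `|b|)%:Z.
Proof.
move=> a0 b0; set x := _ / _.
have x0 : x != 0 by rewrite mulf_neq0 ?invr_eq0 ?intr_eq0.
have /eqP : (numq x * b)%:~R = (a * denq x)%:~R :> rat.
  by rewrite !intrM numqE mulrAC divfK ?intr_eq0.
rewrite eqr_int => /eqP /(congr1 (fun z => logn P `|z|%N)).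
rewrite !abszM !lognM ?absz_gt0 ?numq_eq0 ?denq_neq0 // /ratval.
lia.
Qed.

Lemma ratval_nat P n : (0 < n)%N -> ratval P n%:R = (logn P n)%:Z.
Proof.
move=> n0; have := @ratval_frac P n%:Z 1.
rewrite divr1 -pmulrn => ->; rewrite ?logn1 ?subr0 //.
by rewrite eqz_nat -lt0n.
Qed.

Lemma ratval1 P : ratval P 1 = 0.
Proof. by rewrite (@ratval_nat P 1) // logn1. Qed.

Lemma ratvalM P x y : x != 0 -> y != 0 ->
  ratval P (x * y) = ratval P x + ratval P y.
Proof.
move=> x0 y0.
rewrite -[x in LHS]divq_num_den -[y in LHS]divq_num_den mulf_div -!intrM.
rewrite ratval_frac ?mulf_neq0 ?numq_eq0 ?denq_neq0 //.
by rewrite !abszM !lognM ?absz_gt0 ?numq_eq0 ?denq_neq0 // /ratval; lia.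
Qed.

End Valuation.

(** * Relations and fractions in Gamma *)

Section GammaRelations.
Variables (r : nat) (p y : 'I_r -> nat).
Local Notation G := (Gamma p y).
Local Notation a := (Gamma_a p y).
Local Notation t := (Gamma_t p y).

Lemma Gamma_t_commute i j : commute (t i) (t j).
Proof.
have [->|ij] := eqVneq i j; first exact: commute_refl.
rewrite /commute -!pres_class_cat.
exact/pres_eqP/PresRel/GammaComm.
Qed.

Lemma Gamma_t_a i : t i * a = a ^+ (p i ^ y i) * t i.
Proof.
pose cl w : G := pres_class (Gamma_rel p y) w.
have clM u v : cl (u ++ v) = cl u * cl v by apply: pres_class_cat.
have clX n : cl (nseq n (None, false)) = a ^+ n.
  by elim: n => // n IHn; rewrite expgS -IHn -clM.
have conjE :
    t i * a / t i = cl [:: (Some i, false); (None, false); (Some i, true)].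
  rewrite -[(_, _) :: _]cat1s -[X in _ ++ X]cat1s !clM mulgA.
  by congr (_ * _); apply: pres_invE.
rewrite -clX -[LHS](mulgVK (t i)) conjE; congr (_ * _).
exact/pres_eqP/PresRel/GammaConj.
Qed.

Lemma Gamma_t_aX i n : t i * a ^+ n = a ^+ (p i ^ y i * n) * t i.
Proof.
elim: n => [|n IHn]; first by rewrite muln0 !expg0 mulg1 mul1g.
by rewrite expgS mulgA Gamma_t_a -mulgA IHn mulgA -expgnDr mulnS.
Qed.

Lemma Gamma_ind (P : G -> Prop) :
  P 1 -> (forall x, P x -> P (a * x)) -> (forall x, P x -> P (a^-1 * x)) ->
  (forall i x, P x -> P (t i * x)) ->
  (forall i x, P x -> P ((t i)^-1 * x)) -> forall x, P x.
Proof.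
move=> P1 Pa PaV Pt PtV.
apply: presented_ind => // -[i|] x Px.
- exact: Pt.
- exact: Pa.
- exact: PtV.
- exact: PaV.
Qed.

Lemma Gamma_hom_ext (H : groupType) (f g : G -> H) :
  {morph f : x z / x * z} -> {morph g : x z / x * z} ->
  f a = g a -> (forall i, f (t i) = g (t i)) -> f =1 g.
Proof.
move=> fM gM fga fgt; elim/Gamma_ind => [|x E|x E|i x E|i x E].
- by rewrite (morph_1 fM) (morph_1 gM).
- by rewrite fM gM fga E.
- by rewrite fM gM (morph_V fM) (morph_V gM) fga E.
- by rewrite fM gM fgt E.
- by rewrite fM gM (morph_V fM) (morph_V gM) fgt E.
Qed.

Section Lift.
Variables (H : groupType) (b : H) (s : 'I_r -> H).
Hypothesis sC : forall i j, commute (s i) (s j).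
Hypothesis sb : forall i, s i * b = b ^+ (p i ^ y i) * s i.

Lemma Gamma_lift : exists f : G -> H,
  [/\ {morph f : x y / x * y}, f a = b & forall i, f (t i) = s i].
Proof.
pose g (c : option 'I_r) := if c is Some i then s i else b.
have gR u v : Gamma_rel p y u v -> word_eval g u = word_eval g v.
  case=> [i j _|i]; rewrite /word_eval !big_cons big_nil /= mulg1.
    by rewrite mulg1 sC.
  rewrite mulgA sb mulgK; elim: (_ ^ _)%N => [|k IHk].
    by rewrite big_nil expg0.
  by rewrite big_cons expgS IHk.
exists (presented_lift g); split; first exact: presented_liftM gR.
  exact: presented_lift_gen gR _.
by move=> i; apply: presented_lift_gen gR _.
Qed.

End Lift.

(** Positive words in the t's, as sequences: the counting functions of
    sequences then play the role of exponent vectors. *)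
Definition t_prod (u : seq 'I_r) : G := \prod_(i <- u) t i.

Lemma t_prod_cons i u : t_prod (i :: u) = t i * t_prod u.
Proof. exact: big_cons. Qed.

Lemma t_prod_commute u v : commute (t_prod u) (t_prod v).
Proof.
apply: commute_prod => i _; apply/commute_sym/commute_prod => j _.
exact: Gamma_t_commute.
Qed.

Lemma t_prod_perm u v : perm_eq u v -> t_prod u = t_prod v.
Proof.
apply: catCA_perm_subst => u1 u2 u3.
by rewrite /t_prod !big_cat /= !mulgA -!/(t_prod _) t_prod_commute.
Qed.

Lemma t_prod_a u : exists n, t_prod u * a = a ^+ n * t_prod u.
Proof.
elim: u => [|i u [n IHu]].
  by exists 1%N; rewrite /t_prod big_nil expg1 mul1g mulg1.
exists (p i ^ y i * n)%N.
by rewrite t_prod_cons -mulgA IHu !mulgA Gamma_t_aX.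
Qed.

(** The relations move powers of [a] to the left of the t's, in positive
    powers only, so that a generator or an inverse put on the left of x can be
    absorbed by enlarging the numerator or the denominator.  Allowing powers of
    [a] in the denominator keeps all exponents natural numbers. *)
Lemma Gamma_fraction x :
  exists m u n v, a ^+ m * t_prod u * x = a ^+ n * t_prod v.
Proof.
elim/Gamma_ind: x => [|x|x|i x|i x].
- by exists 0%N, [::], 0%N, [::]; rewrite mulg1.
- move=> [m [u [n [v E]]]]; have [N uN] := t_prod_a u.
  exists m, u, (N + n)%N, v.
  rewrite (expgnDr a N n) -[RHS]mulgA -E [LHS]mulgA -[_ * a]mulgA uN.
  by rewrite !mulgA -!expgnDr addnC.
- move=> [m [u [n [v E]]]]; have [N uN] := t_prod_a u.
  exists (m + N)%N, u, n, v.
  by rewrite expgnDr -[a ^+ m * _ * _]mulgA -uN -E !mulgA mulgK.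
- move=> [m [u [n [v E]]]].
  exists (p i ^ y i * m)%N, u, (p i ^ y i * n)%N, (i :: v).
  have ut : t_prod u * t i = t i * t_prod u.
    by have := t_prod_commute u [:: i]; rewrite /commute /t_prod big_seq1.
  rewrite t_prod_cons [RHS]mulgA -Gamma_t_aX -[RHS]mulgA -E mulgA.
  by rewrite -[_ * t i]mulgA ut !mulgA -Gamma_t_aX.
- move=> [m [u [n [v E]]]].
  exists m, (rcons u i), n, v.
  by rewrite /t_prod big_rcons /= -!mulgA mulVKg mulgA.
Qed.

End GammaRelations.

(** * The affine action of Gamma *)

Section GammaAction.
Variables (r : nat) (p y : 'I_r -> nat).
Hypothesis p_pr : forall i, prime (p i).
Local Notation G := (Gamma p y).
Local Notation a := (Gamma_a p y).
Local Notation t := (Gamma_t p y).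
Local Open Scope ring_scope.

Fact q_gt0 i : (0 < p i ^ y i)%N.
Proof. by rewrite expn_gt0 prime_gt0. Qed.

Lemma Gamma_affine : exists f : G -> affine,
  [/\ {morph f : x z / (x * z)%g}, f a = translation
    & forall i, f (t i) = dilation (q_gt0 i)].
Proof.
apply: Gamma_lift => i => [j|]; first exact: dilation_commute.
exact: dilation_translation.
Qed.

Definition Gamma_to_affine : G -> affine := sval (cid Gamma_affine).

Lemma Gamma_to_affineM : {morph Gamma_to_affine : x z / (x * z)%g}.
Proof. by rewrite /Gamma_to_affine; case: cid => f []. Qed.

Lemma Gamma_to_affine_a : Gamma_to_affine a = translation.
Proof. by rewrite /Gamma_to_affine; case: cid => f []. Qed.

Lemma Gamma_to_affine_t i : Gamma_to_affine (t i) = dilation (q_gt0 i).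
Proof. by rewrite /Gamma_to_affine; case: cid => f []. Qed.

Definition slope x := (val (Gamma_to_affine x)).1.
Definition shift x := (val (Gamma_to_affine x)).2.

Lemma slope_gt0 x : 0 < slope x. Proof. exact: (valP (Gamma_to_affine x)). Qed.

Lemma slope_neq0 x : slope x != 0. Proof. by rewrite gt_eqF ?slope_gt0. Qed.

Lemma slopeM x z : slope (x * z)%g = slope x * slope z.
Proof. by rewrite /slope Gamma_to_affineM. Qed.

Lemma shiftM x z : shift (x * z)%g = shift x + slope x * shift z.
Proof. by rewrite /shift /slope Gamma_to_affineM. Qed.

Lemma slope1 : slope 1%g = 1.
Proof. by apply: (mulfI (slope_neq0 1%g)); rewrite -slopeM mulg1 mulr1. Qed.

Lemma shift1 : shift 1%g = 0.
Proof.
apply: (addrI (shift 1%g)).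
by rewrite -{2}[shift 1%g]mul1r -slope1 -shiftM mulg1 addr0.
Qed.

Lemma slopeV x : slope x^-1%g = (slope x)^-1.
Proof.
apply: (mulfI (slope_neq0 x)).
by rewrite -slopeM mulgV slope1 mulfV ?slope_neq0.
Qed.

Lemma slopeX x n : slope (x ^+ n)%g = slope x ^+ n.
Proof. by elim: n => [|n IHn]; rewrite ?slope1 // expgS slopeM IHn exprS. Qed.

Lemma slope_a : slope a = 1.
Proof. by rewrite /slope Gamma_to_affine_a. Qed.

Lemma shift_a : shift a = 1.
Proof. by rewrite /shift Gamma_to_affine_a. Qed.

Lemma slope_t i : slope (t i) = (p i ^ y i)%:R.
Proof. by rewrite /slope Gamma_to_affine_t. Qed.

Lemma shift_t i : shift (t i) = 0.
Proof. by rewrite /shift Gamma_to_affine_t. Qed.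

Lemma shiftX x n : slope x = 1 -> shift (x ^+ n)%g = shift x *+ n.
Proof.
move=> x1; elim: n => [|n IHn]; first by rewrite expg0 shift1.
by rewrite expgS shiftM x1 mul1r IHn mulrS.
Qed.

Lemma shift_t_prod u : shift (t_prod p y u) = 0.
Proof.
elim: u => [|i u IHu]; first by rewrite /t_prod big_nil shift1.
by rewrite t_prod_cons shiftM shift_t IHu mulr0 addr0.
Qed.

Hypothesis p_inj : injective p.
Hypothesis y_gt0 : forall i, (0 < y i)%N.

Definition slope_val (P : nat) (x : G) : int := ratval P (slope x).

Lemma slope_valM P x z : slope_val P (x * z)%g = slope_val P x + slope_val P z.
Proof. by rewrite /slope_val slopeM ratvalM ?slope_neq0. Qed.

Lemma slope_val1 P : slope_val P 1%g = 0.
Proof.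
by apply: (addrI (slope_val P 1%g)); rewrite -slope_valM mulg1 addr0.
Qed.

Lemma slope_valV P x : slope_val P x^-1%g = - slope_val P x.
Proof. by apply/eqP; rewrite -addr_eq0 -slope_valM mulVg slope_val1. Qed.

Lemma slope_valX P x n : slope_val P (x ^+ n)%g = slope_val P x *+ n.
Proof.
elim: n => [|n IHn]; first by rewrite expg0 slope_val1.
by rewrite expgS slope_valM IHn mulrS.
Qed.

Lemma slope_val_a P : slope_val P a = 0.
Proof. by rewrite /slope_val slope_a ratval1. Qed.

Lemma slope_val_t P i : slope_val P (t i) = (y i * (P == p i))%:Z.
Proof.
by rewrite /slope_val slope_t ratval_nat ?q_gt0 // lognX logn_prime.
Qed.

Lemma slope_val_t_prod i u :
  slope_val (p i) (t_prod p y u) = (y i * count_mem i u)%:Z.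
Proof.
elim: u => [|j u IHu]; first by rewrite /t_prod big_nil slope_val1 muln0.
rewrite t_prod_cons slope_valM IHu slope_val_t (inj_eq p_inj) eq_sym /=.
by case: eqVneq => [->|_] /=; lia.
Qed.

(** In a fraction [a^m T(u) x = a^n T(v)], comparing slopes gives
    T(u) and T(v) the same ratio, so u and v agree up to order by unique
    factorization; then comparing the images of 0 gives m = n. *)
Lemma Gamma_faithful x : slope x = 1 -> shift x = 0 -> x = 1%g.
Proof.
move=> sx1 x0; have [m [u [n [v E]]]] := Gamma_fraction x.
have uv : t_prod p y u = t_prod p y v.
  apply/t_prod_perm/allP => i _ /=; apply/eqP.
  move/(congr1 (slope_val (p i))): E.
  rewrite !slope_valM !slope_valX slope_val_a !mul0rn !add0r.
  rewrite !slope_val_t_prod /slope_val sx1 ratval1 addr0 => -[].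
  by move/eqP; rewrite eqn_pmul2l // => /eqP.
have mn : m = n.
  move/(congr1 shift): E; rewrite !shiftM x0 shift_t_prod.
  rewrite !shift_t_prod !mulr0 !addr0 !shiftX ?slope_a // shift_a.
  by move/eqP; rewrite eqr_nat => /eqP.
by apply: (mulgI (a ^+ m * t_prod p y u)%g); rewrite mulg1 E mn uv.
Qed.

Lemma Gamma_to_affine_inj : injective Gamma_to_affine.
Proof.
move=> x z xz; apply/divg1_eq/Gamma_faithful.
  by rewrite slopeM slopeV /slope xz mulfV // slope_neq0.
apply: (addIr (slope (x / z)%g * shift z)).
rewrite -shiftM mulgVK add0r slopeM slopeV /shift /slope xz.
by rewrite mulfV ?mul1r ?slope_neq0.
Qed.

(** The slopes are generated by powers of single primes, and each generator is
    either its own P-part or has a trivial one; the element z with the P-part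
    of the slope of x is obtained by erasing the other generators from a word
    for x. *)
Lemma slope_split x P : exists z, forall Q,
  slope_val Q z = if Q == P then slope_val P x else 0.
Proof.
elim/Gamma_ind: x => [|x [z E]|x [z E]|i x [z E]|i x [z E]].
- by exists 1%g => Q; rewrite !slope_val1 if_same.
- by exists z => Q; rewrite E slope_valM slope_val_a add0r.
- by exists z => Q; rewrite E slope_valM slope_valV slope_val_a oppr0 add0r.
- exists ((if P == p i then t i else 1) * z)%g => Q.
  rewrite !slope_valM E slope_val_t; case: (eqVneq P (p i)) => [->|Pi].
    by rewrite slope_val_t; case: eqVneq; rewrite ?muln0 ?addr0.
  by rewrite slope_val1 muln0 !add0r.
- exists ((if P == p i then (t i)^-1 else 1) * z)%g => Q.
  rewrite !slope_valM E !slope_valV slope_val_t.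
  case: (eqVneq P (p i)) => [->|Pi].
    by rewrite slope_valV slope_val_t; case: eqVneq; rewrite ?muln0 ?addr0.
  by rewrite slope_val1 muln0 oppr0 !add0r.
Qed.

End GammaAction.

Lemma subgroup_gen_ind (G : groupType) (S A : set G) :
  is_subgroup A -> (forall x, S x -> A x) -> forall x, subgroup_gen S x -> A x.
Proof. by move=> sA SA x; apply. Qed.

Lemma mem_subgroup_gen (G : groupType) (S : set G) x :
  S x -> x \in subgroup_gen S.
Proof. by move=> Sx; apply/mem_set => A [_]; apply. Qed.

(** * Embeddings preserve slopes *)

Section Embedding.
Variables (r : nat) (p y : 'I_r -> nat) (s : nat) (p' y' : 'I_s -> nat).
Hypotheses (p_pr : forall i, prime (p i)) (p_inj : injective p)
  (y_gt0 : forall i, (0 < y i)%N).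
Hypotheses (p'_pr : forall i, prime (p' i)) (y'_gt0 : forall i, (0 < y' i)%N).
Variable g : Gamma p' y' -> Gamma p y.
Hypotheses (gM : {morph g : x z / x * z}) (g_inj : injective g).

(** Write b for the image of [a] and T_i for that of [t_i].  The relation
    [T_i b = b^q T_i], with q > 1, forces the slope of b to be 1 by comparison
    of slopes.  So b is a translation, nontrivial because the action is
    faithful, and comparison of translation lengths shows that T_i multiplies
    it by q.  At least one generator [t_i] is needed: otherwise the source is
    infinite cyclic and [a] may be sent to any element of infinite order. *)
Lemma slope_embedding x : (0 < s)%N -> slope p_pr (g x) = slope p'_pr x.
Proof.
case: s p' y' p'_pr y'_gt0 g gM g_inj x => // s' P Y P_pr Y_gt0 h hM h_inj x _.
pose b := h (Gamma_a P Y); pose T i := h (Gamma_t P Y i).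
have q_gt1 i : (1 < P i ^ Y i)%N.
  by rewrite -(exp1n (Y i)) ltn_exp2r // prime_gt1.
have Tb i : T i * b = b ^+ (P i ^ Y i) * T i.
  by rewrite -hM Gamma_t_a hM morph_X.
have b1 : slope p_pr b = 1%R.
  have := congr1 (slope p_pr) (Tb ord0); rewrite !slopeM slopeX mulrC.
  move/(mulIf (slope_neq0 _ _)).
  case: (P ord0 ^ Y ord0)%N (q_gt1 ord0) => [|[|n]] // _.
  rewrite exprS -{1}[slope _ b]mulr1 => /(mulfI (slope_neq0 _ _))/esym/eqP.
  by rewrite pexpr_eq1 ?ltW ?slope_gt0 // => /eqP.
have b0 : shift p_pr b != 0%R.
  apply/eqP => b0; have /h_inj/(congr1 (shift P_pr)) : b = h 1.
    by rewrite (morph_1 hM); apply: Gamma_faithful b1 b0.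
  by rewrite shift_a shift1.
have T_slope i : slope p_pr (T i) = slope P_pr (Gamma_t P Y i).
  have := congr1 (shift p_pr) (Tb i); rewrite !shiftM slopeX shiftX // b1.
  rewrite expr1n mul1r addrC => /addIr.
  by rewrite -mulr_natl slope_t => /(mulIf b0).
elim/Gamma_ind: x => [|x IHx|x IHx|i x IHx|i x IHx].
- by rewrite (morph_1 hM) !slope1.
- by rewrite hM !slopeM IHx b1 slope_a.
- by rewrite hM (morph_V hM) !slopeM !slopeV IHx b1 slope_a.
- by rewrite hM !slopeM IHx T_slope.
- by rewrite hM (morph_V hM) !slopeM !slopeV IHx T_slope.
Qed.

End Embedding.

(** * The subgroup H *)

Section HSubgroup.
Variables (r : nat) (p y : 'I_r -> nat) (K : 'I_r -> 'I_r -> nat) (m : nat).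
Hypotheses (p_pr : forall i, prime (p i)) (p_inj : injective p)
  (y_gt0 : forall i, (0 < y i)%N).
Local Notation G := (Gamma p y).
Local Notation a := (Gamma_a p y).
Local Notation t := (Gamma_t p y).
Local Notation H := (subgroup_gen (H_gens p y K m)).

Definition H_t (i : 'I_r) : G := \prod_(j < r | (i <= j)%N) t j ^+ K i j.

Lemma H_t_mem i : H_t i \in H.
Proof. by apply: mem_subgroup_gen; left; exists i. Qed.

Lemma H_a_mem : a ^+ m \in H.
Proof. by apply: mem_subgroup_gen; right. Qed.

Lemma slope_val_H_t i j :
  slope_val p_pr (p j) (H_t i) =
  ((if (i <= j)%N then y j * K i j else 0)%N%:Z)%R.
Proof.
rewrite /H_t (big_morph _ (slope_valM p_pr (p j)) (slope_val1 _ p_pr _)).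
rewrite (eq_bigr (fun l => if l == j then (y j * K i j)%N%:Z else 0)%R);
  last first.
  move=> l _; rewrite slope_valX slope_val_t (inj_eq p_inj) eq_sym.
  by case: eqVneq => [->|_] /=; lia.
by rewrite -big_mkcondr /= big_mkcond /= (bigD1 j) //= eqxx andbT big1 ?addr0
  => [|l /negPf ->]; [case: ifP|rewrite andbF].
Qed.

(** The vectors of valuations of the slopes of H lie in the lattice spanned by
    the rows of the upper triangular matrix with entries [y j * K i j], since
    those rows come from the generators [H_t i], and [a ^+ m] has slope 1. *)
Lemma H_slope_lattice x : H x -> exists c : 'I_r -> int, forall j,
  slope_val p_pr (p j) x =
  (\sum_i c i * (if (i <= j)%N then y j * K i j else 0)%N%:Z)%R.
Proof.
move: x; apply: subgroup_gen_ind; first split.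
- exists (fun=> 0%R) => j; rewrite slope_val1 big1 // => i _; exact: mul0r.
- move=> x z [c cE] [d dE]; exists (fun i => c i - d i)%R => j.
  rewrite slope_valM slope_valV cE dE -sumrB; apply: eq_bigr => i _.
  by rewrite mulrBl.
- move=> x [[i ->]|->].
    exists (fun l => (l == i)%:Z)%R => j; rewrite -/(H_t i) slope_val_H_t.
    rewrite (bigD1 i) //= eqxx mul1r big1 ?addr0 // => l /negPf ->.
    exact: mul0r.
  exists (fun=> 0%R) => j; rewrite slope_valX slope_val_a mul0rn.
  by rewrite big1 // => i _; apply: mul0r.
Qed.

(** Triangularity: if the valuations vanish before position j, then the
    coefficients of the rows before j vanish too, so that only row j contributes
    to the valuation in position j. *)
Lemma H_slope_dvd x (j : 'I_r) : (forall i, 0 < K i i)%N -> H x ->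
  (forall i : 'I_r, (i < j)%N -> slope_val p_pr (p i) x = 0%R) ->
  exists c : int, slope_val p_pr (p j) x = (c * (y j * K j j)%N%:Z)%R.
Proof.
move=> K_gt0 /H_slope_lattice[c cE] x0.
have tri (l : 'I_r) : (forall i : 'I_r, (i < l)%N -> c i = 0%R) ->
    slope_val p_pr (p l) x = (c l * (y l * K l l)%N%:Z)%R.
  move=> c0; rewrite cE (bigD1 l) //= leqnn big1 ?addr0 // => i il.
  have [il'|] := leqP i l; last by rewrite mulr0.
  by rewrite c0 ?mul0r // ltn_neqAle il.
exists (c j); apply: (tri j).
suff c0 n (i : 'I_r) : (i < n)%N -> (i < j)%N -> c i = 0%R.
  by move=> i; apply: (c0 i.+1).
elim: n i => // n IHn i; rewrite ltnS => le_in ij.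
have := tri i; rewrite x0 // => /(_ _)/esym/eqP.
rewrite mulf_eq0 eqz_nat muln_eq0 !eqn0Ngt y_gt0 K_gt0 orbF => h.
apply/eqP/h => l li; apply: IHn; first exact: leq_trans li le_in.
exact: ltn_trans li ij.
Qed.

(** The p_j-part of the slope of [H_t i] is again the slope of an element of H,
    because H has the same slopes as Gamma_k; its only nonzero valuation is
    [y j * K i j], which must therefore be a multiple of [y j * K j j]. *)
Lemma H_gens_rigid k : (2 <= k)%N -> (forall i, 0 < K i i)%N ->
  (forall i j : 'I_r, (i < j)%N -> (K i j < K j j)%N) ->
  isomorphic_to_Gamma (subgroup_type (H_gens p y K m)) k ->
  forall i j : 'I_r, (i < j)%N -> K i j = 0%N.
Proof.
move=> k2 K_gt0 Klt [s [p' [y' [[p'_pr p'_inj y'_gt0 kE]]]]].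
move=> /isomorphic_sym[g [g' gK g'K]] i j ij.
pose f x : G := val (g x).
have fM : {morph f : x z / x * z} by move=> x z; rewrite /f gmulfM.
have f_inj : injective f by move=> x z /val_inj/(can_inj gK).
have s_gt0 : (0 < s)%N.
  rewrite lt0n; apply/eqP => s0; move: k2; rewrite kE.
  by rewrite big1 // => -[l ls]; exfalso; rewrite s0 in ls.
have fslope x := slope_embedding p_pr p_inj y_gt0 p'_pr y'_gt0 fM f_inj x s_gt0.
pose h : subgroup_type (H_gens p y K m) := Sub (H_t i) (H_t_mem i).
have [z zE] := slope_split p'_pr (g' h) (p j).
have fzE l : slope_val p_pr (p l) (f z) =
    (if l == j then (y j * K i j)%N%:Z else 0)%R.
  rewrite /slope_val fslope -/(slope_val p'_pr (p l) z) zE (inj_eq p_inj).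
  case: eqP => // _; rewrite /slope_val -fslope /f g'K -/(slope_val _ _ _).
  by rewrite slope_val_H_t ltnW.
have [l lj|c] := @H_slope_dvd (f z) j K_gt0 (set_mem (valP (g z))).
  by rewrite fzE; case: eqVneq lj => // ->; rewrite ltnn.
rewrite fzE eqxx => /eqP; rewrite !PoszM mulrCA.
have yj := y_gt0 j; have Kij := Klt i j ij.
rewrite (inj_eq (mulfI _)); last by rewrite eqz_nat -lt0n.
move=> /eqP; case: c => [[|c]|c]; nia.
Qed.

(** The morphism [t_i |-> t_i ^ K_ii, a |-> a ^ m] becomes, on affine maps,
    conjugation by the dilation of ratio m; this reduces its injectivity to the
    faithfulness of the two actions. *)
Lemma H_gens_diagonal : (forall i, 0 < K i i)%N ->
  (forall i j : 'I_r, (i < j)%N -> K i j = 0%N) -> (0 < m)%N ->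
  isomorphic (subgroup_type (H_gens p y K m))
             (Gamma p (fun i => y i * K i i)%N).
Proof.
move=> K_gt0 K0 m_gt0; apply: isomorphic_sym.
set y' : 'I_r -> nat := fun i => (y i * K i i)%N.
have y'_gt0 i : (0 < y' i)%N by rewrite muln_gt0 y_gt0 K_gt0.
pose HT := subgroup_type (H_gens p y K m).
have vM : {morph (val : HT -> G) : x z / x * z} by move=> x z; apply: gmulfM.
pose b : HT := Sub (a ^+ m) H_a_mem.
pose T i : HT := Sub (H_t i) (H_t_mem i).
have TE i : val (T i) = t i ^+ K i i.
  rewrite /= /H_t (eq_bigr (fun j => if j == i then t i ^+ K i i else 1)).
    rewrite -big_mkcondr (eq_bigl (pred1 i)) ?big_pred1_eq // => j.
    by rewrite andbC /=; case: eqVneq => // ->; rewrite leqnn.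
  move=> j ij; case: eqVneq => [->//|ji].
  by rewrite K0 // ltn_neqAle eq_sym ji.
have tXa i n : t i ^+ n * a ^+ m = a ^+ (p i ^ (y i * n) * m) * t i ^+ n.
  elim: n => [|n IHn]; first by rewrite muln0 mul1n expg0 mulg1 mul1g.
  by rewrite expgS -mulgA IHn mulgA Gamma_t_aX -mulgA mulnA -expnD -mulnS.
have bX n : val (b ^+ n) = a ^+ (n * m).
  by rewrite (morph_X _ vM) mulnC expgnA.
have [||f [fM fa ft]] := @Gamma_lift r p y' HT b T.
- move=> i j; apply: val_inj; rewrite !vM !TE.
  exact: commuteX2 (Gamma_t_commute _ _ _ _).
- by move=> i; apply: val_inj; rewrite !vM bX TE tXa.
pose phi x : G := val (f x).
have phiM : {morph phi : x z / x * z} by move=> x z; rewrite /phi fM vM.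
have phi_a : phi (Gamma_a p y') = a ^+ m by rewrite /phi fa.
have phi_t i : phi (Gamma_t p y' i) = t i ^+ K i i by rewrite /phi ft TE.
have phiE x : Gamma_to_affine p_pr (phi x) =
    Gamma_to_affine p_pr x ^ (dilation m_gt0)^-1.
  move: x; apply: Gamma_hom_ext => [x z|x z||i].
  - by rewrite phiM Gamma_to_affineM.
  - by rewrite Gamma_to_affineM conjMg.
  - rewrite phi_a (morph_X _ (@Gamma_to_affineM _ _ _ p_pr)) !Gamma_to_affine_a.
    by apply: (mulIg (dilation m_gt0)); rewrite -conjgCV dilation_translation.
  - rewrite phi_t (morph_X _ (@Gamma_to_affineM _ _ _ p_pr)) !Gamma_to_affine_t.
    apply: (mulIg (dilation m_gt0)); rewrite -conjgCV -dilation_commute.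
    by congr (_ * _); apply: dilationX; rewrite -expnM.
apply: (morph_isomorphic fM) => [x z xz|[x xH]].
  apply: (@Gamma_to_affine_inj _ _ _ p_pr p_inj y'_gt0).
  apply: (conjg_inj (dilation m_gt0)^-1).
  by rewrite -!phiE /phi xz.
suff [z zE] : exists z, phi z = x by exists z; apply: val_inj.
move: x {xH} (set_mem xH); apply: subgroup_gen_ind.
  split; first by exists 1; rewrite (morph_1 phiM).
  by move=> x z [u <-] [v <-]; exists (u / v); rewrite phiM (morph_V phiM).
move=> x [[i ->]|->]; last by exists (Gamma_a p y').
by exists (Gamma_t p y' i); rewrite phi_t -TE.
Qed.

End HSubgroup.

Local Close Scope group_scope.

Theorem theorem3p9 (n r : nat) (p y : 'I_r -> nat)
    (K : 'I_r -> 'I_r -> nat) (m : nat) :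
  2 <= n ->
  prime_decomposition n p y ->
  (forall i : 'I_r, i = 0 :> nat -> 0 < K i i) ->
  (forall i j : 'I_r, i < j -> K i j < K j j) ->
  0 < m ->
  coprime m n ->
  finite_index (subgroup_gen (H_gens p y K m)) ->
  ((exists k : nat,
      2 <= k /\ isomorphic_to_Gamma (subgroup_type (H_gens p y K m)) k)
   <-> (forall i j : 'I_r, i < j -> K i j = 0)).
Proof.
move=> n_ge2 [p_pr p_inj y_gt0 nE] K0_gt0 Klt m_gt0 _ _.
(* Beyond the first column, the bound on the entries above the diagonal makes
   the diagonal entry positive. *)
have K_gt0 i : 0 < K i i.
  have [i0|i_gt0] := posnP i; first exact: K0_gt0.
  pose i1 := Ordinal (ltn_trans i_gt0 (ltn_ord i)).
  exact: leq_ltn_trans (leq0n _) (Klt i1 i i_gt0).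
split=> [[k [k_ge2 Hk]]|K0]; first exact: H_gens_rigid k_ge2 K_gt0 Klt Hk.
exists (\prod_(i < r) p i ^ (y i * K i i)); split.
  apply: leq_trans n_ge2 _; rewrite nE leq_prod // => i _.
  by rewrite leq_exp2l ?prime_gt1 // leq_pmulr.
exists r, p, (fun i => y i * K i i); split; last exact: H_gens_diagonal.
by split=> // i; rewrite muln_gt0 y_gt0 K_gt0.
Qed.
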